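(* Let $F$ be a field of characteristic different from $2$ and let $D$ be a central division algebra over $F$. Let $x\in D^\times\setminus F$ be a square-central element (that is, $x^2\in F^\times$) which is in no quaternion $F$-subalgebra of $D$. Let $L=F((t_1))((t_2))$ be the iterated Laurent power series field, where $t_1,t_2$ are independent indeterminates over $F$. Then $D\otimes_F(t_1,t_2)_L$ has no quaternion $L$-subalgebra containing $x$ (where $x$ is identified with $x\otimes1$).
   Context: All algebras are associative and finite-dimensional over their center. For a field $K$ of characteristic different from $2$ and $a,b\in K^\times$, $(a,b)_K$ denotes the quaternion $K$-algebra generated by $i,j$ with $i^2=a$, $j^2=b$, $ij=-ji$. *)

(* Defs.v *)
From HB Require Import structures.
From mathcomp Require Import all_boot all_order all_algebra all_field.
From mathcomp Require Import boolp classical_sets fsbigop.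
From mathcomp Require Import zify ring.

Set Implicit Arguments.
Unset Strict Implicit.
Unset Printing Implicit Defensive.
Import Order.TTheory GRing.Theory Num.Theory.
Local Open Scope ring_scope.

(* laurent F is the field F((t)): a series is the family of its coefficients,
   indexed by int and vanishing below some index.                            *)
Record laurent (F : fieldType) := Laurent {
  lcoef :> int -> F;
  lcoef_bounded : exists N : int, forall n, n < N -> lcoef n = 0
}.

HB.instance Definition _ (F : fieldType) := gen_eqMixin (laurent F).
HB.instance Definition _ (F : fieldType) := gen_choiceMixin (laurent F).

Section Laurent.
Variable F : fieldType.
Implicit Types f g h : laurent F.

Definition lbelow (f : int -> F) (N : int) := forall n, n < N -> f n = 0.

Lemma laurentP f g : lcoef f =1 lcoef g -> f = g.
Proof.
case: f g => [f fN] [g gN] /= /funext efg; subst g.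
by congr Laurent; apply: Prop_irrelevance.
Qed.

Lemma lconst_bounded (a : F) :
  exists N : int, lbelow (fun n => if n == 0 then a else 0) N.
Proof. by exists 0 => n n0; rewrite ifF //; apply: lt_eqF. Qed.
Definition laurentC (a : F) : laurent F := Laurent (lconst_bounded a).

Lemma lvar_bounded : exists N : int, lbelow (fun n => (n == 1)%:R) N.
Proof. by exists 0 => n n0; rewrite (_ : (n == 1) = false) //; lia. Qed.
Definition laurentX : laurent F := Laurent lvar_bounded.

Lemma ladd_bounded f g : exists N : int, lbelow (fun n => f n + g n) N.
Proof.
case: (lcoef_bounded f) (lcoef_bounded g) => [M fM] [N gN].
by exists (Num.min M N) => n; rewrite lt_min => /andP[/fM -> /gN ->]; rewrite addr0.
Qed.
Definition ladd f g := Laurent (ladd_bounded f g).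

Lemma lopp_bounded f : exists N : int, lbelow (fun n => - f n) N.
Proof.
by case: (lcoef_bounded f) => [N fN]; exists N => n /fN ->; rewrite oppr0.
Qed.
Definition lopp f := Laurent (lopp_bounded f).

Lemma laddA : associative ladd.
Proof. by move=> f g h; apply/laurentP => n /=; rewrite addrA. Qed.
Lemma laddC : commutative ladd.
Proof. by move=> f g; apply/laurentP => n /=; rewrite addrC. Qed.
Lemma ladd0 : left_id (laurentC 0) ladd.
Proof. by move=> f; apply/laurentP => n /=; rewrite if_same add0r. Qed.
Lemma laddN : left_inverse (laurentC 0) lopp ladd.
Proof. by move=> f; apply/laurentP => n /=; rewrite if_same addNr. Qed.

HB.instance Definition _ :=
  GRing.isZmodule.Build (laurent F) laddA laddC ladd0 laddN.

(* The sum over all integers i has finite support. *)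
Definition lmulc (f g : int -> F) (n : int) : F :=
  \sum_(i \in [set: int]) f i * g (n - i).

Lemma lmulc_below f g M N :
  lbelow f M -> lbelow g N -> lbelow (lmulc f g) (M + N).
Proof.
move=> fM gN n nMN; apply: fsbig1 => i _.
have [/fM ->|Mi] := ltP i M; first by rewrite mul0r.
by rewrite gN ?mulr0 //; lia.
Qed.

Lemma lmul_bounded f g : exists N : int, lbelow (lmulc f g) N.
Proof.
case: (lcoef_bounded f) (lcoef_bounded g) => [M fM] [N gN].
by exists (M + N); apply: lmulc_below.
Qed.
Definition lmul f g := Laurent (lmul_bounded f g).

Lemma lmulcE f g M N (n : nat) : lbelow f M -> lbelow g N ->
  lmulc f g (M + N + n%:Z) =
  \sum_(i < n.+1) f (M + i%:Z) * g (N + (n - i)%N%:Z).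
Proof.
move=> fM gN; rewrite /lmulc.
rewrite (@fsbigE _ _ _ _ _ [seq M + i%:Z | i <- iota 0 n.+1]) //.
- rewrite big_map -{1}(subn0 n.+1) -/(index_iota 0 n.+1) big_mkord.
  apply: eq_big => [i|i _]; first by rewrite mem_set.
  by congr (_ * lcoef g _); have := ltn_ord i; lia.
- rewrite map_inj_uniq ?iota_uniq // => i j; lia.
- move=> i _ iMn; have [/fM ->|Mi] := ltP i M; first by rewrite mul0r.
  rewrite gN ?mulr0 //; have [//|niN] := ltP (M + N + n%:Z - i) N.
  case/negP: iMn; apply/mapP; exists `|i - M|%N; last by lia.
  by rewrite mem_iota; lia.
Qed.

Definition lpoly (f : int -> F) (M : int) k := \poly_(i < k) f (M + i%:Z).

Lemma lmulc_poly f g M N (n k : nat) : lbelow f M -> lbelow g N -> (n < k)%N ->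
  lmulc f g (M + N + n%:Z) = (lpoly f M k * lpoly g N k)`_n.
Proof.
move=> fM gN nk; rewrite lmulcE // coefM; apply: eq_bigr => i _.
by rewrite !coef_poly !ifT //; have := ltn_ord i; lia.
Qed.

Lemma laurent_shiftP f g M : lbelow f M -> lbelow g M ->
  (forall n : nat, f (M + n%:Z) = g (M + n%:Z)) -> f = g.
Proof.
move=> fM gM efg; apply/laurentP => m.
have [mM|Mm] := ltP m M; first by rewrite fM ?gM.
by have -> : m = M + `|m - M|%N%:Z by lia.
Qed.

Lemma lmulA : associative lmul.
Proof.
move=> f g h.
case: (lcoef_bounded f) (lcoef_bounded g) (lcoef_bounded h) => [M fM] [N gN] [R hR].
have fgMN := lmulc_below fM gN; have ghNR := lmulc_below gN hR.
apply: (@laurent_shiftP _ _ (M + N + R)); [rewrite -addrA| |];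
  do ?exact: lmulc_below.
move=> n /=; rewrite [in RHS](@lmulcE (lmul f g)) // -[M + N + R]addrA.
rewrite (@lmulcE _ (lmul g h)) //.
transitivity (lpoly f M n.+1 * (lpoly g N n.+1 * lpoly h R n.+1))`_n.
  rewrite coefM; apply: eq_bigr => i _ /=.
  by rewrite (@lmulc_poly _ _ _ _ _ n.+1) ?coef_poly ?ltn_ord // ltnS leq_subr.
rewrite mulrA coefM; apply: eq_bigr => i _ /=.
by rewrite (@lmulc_poly _ _ _ _ _ n.+1) // coef_poly ltnS leq_subr.
Qed.

Lemma lmulC : commutative lmul.
Proof.
move=> f g; case: (lcoef_bounded f) (lcoef_bounded g) => [M fM] [N gN].
apply: (@laurent_shiftP _ _ (M + N)); [|rewrite addrC|]; do ?exact: lmulc_below.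
move=> n /=; rewrite (@lmulc_poly _ _ _ _ _ n.+1) // mulrC addrC.
by rewrite -(@lmulc_poly g f) //; congr lmulc; lia.
Qed.

Lemma lmulDl : left_distributive lmul ladd.
Proof.
move=> f g h; apply/laurentP => m /=.
case: (lcoef_bounded f) (lcoef_bounded g) (lcoef_bounded h) => [M0 fM] [M1 gM] [N hN].
pose M : int := Num.min M0 M1.
have {}fM : lbelow f M by move=> n; rewrite lt_min => /andP[/fM].
have {}gM : lbelow g M by move=> n; rewrite lt_min => /andP[_ /gM].
have fgM : lbelow (ladd f g) M by move=> n nM /=; rewrite fM ?gM ?addr0.
have [mMN|MNm] := ltP m (M + N); first
    by rewrite (lmulc_below fM hN mMN) (lmulc_below gM hN mMN) (lmulc_below fgM hN mMN) addr0.
have -> : m = M + N + (absz (m - (M + N))%R)%:Z by lia.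
rewrite (@lmulcE (ladd f g)) // !lmulcE // -big_split /=.
by apply: eq_bigr => i _; rewrite mulrDl.
Qed.

Lemma lmul1 : left_id (laurentC 1) lmul.
Proof.
move=> f; case: (lcoef_bounded f) => [N fN].
have b1 : lbelow (laurentC 1) 0 by move=> n n0 /=; rewrite lt_eqF.
apply: (@laurent_shiftP _ _ N) => //; first by rewrite -[N]add0r; apply: lmulc_below.
move=> n; have := lmulcE n b1 fN; rewrite add0r => E.
rewrite [LHS]E big_ord_recl /= mul1r subn0.
by rewrite big1 ?addr0 // => i _ /=; rewrite mul0r.
Qed.

Lemma laurent1_neq0 : laurentC 1 != laurentC 0.
Proof.
apply/eqP => /(congr1 (fun f : laurent F => f 0)) /= /eqP.
by rewrite (negPf (oner_neq0 F)).
Qed.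

HB.instance Definition _ := GRing.Zmodule_isComNzRing.Build (laurent F)
  lmulA lmulC lmul1 lmulDl laurent1_neq0.

Lemma lcoefD f g n : (f + g) n = f n + g n. Proof. by []. Qed.
Lemma lcoefN f n : (- f) n = - f n. Proof. by []. Qed.
Lemma lcoef0 n : (0 : laurent F) n = 0. Proof. exact: if_same. Qed.
Lemma lcoef1 n : (1 : laurent F) n = if n == 0 then 1 else 0. Proof. by []. Qed.
Lemma lcoefM f g n : (f * g) n = lmulc f g n. Proof. by []. Qed.

Lemma laurent_order f : f != 0 -> exists2 M, f M != 0 & lbelow f M.
Proof.
move=> f0; case: (lcoef_bounded f) => [N fN].
have exn : exists n : nat, f (N + n%:Z) != 0.
  apply: contrapT => nex; case/eqP: f0; apply: (laurent_shiftP fN).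
    by move=> n _; exact: lcoef0.
  by move=> n; rewrite lcoef0; apply/eqP/negPn/negP => fn0; apply: nex; exists n.
case: (ex_minnP exn) => m fm0 min_m; exists (N + m%:Z) => // n nm.
have [/fN //|Nn] := ltP n N.
have -> : n = N + `|n - N|%N%:Z by lia.
apply/eqP/negPn/negP => /min_m; lia.
Qed.

Section PowerSeriesInverse.
Variable p : nat -> F.
Hypothesis p0 : p 0 != 0.

Definition psinv_step (s : seq F) : seq F :=
  rcons s ((p 0)^-1 * ((size s == 0)%:R - \sum_(i < size s) s`_i * p (size s - i))).
Definition psinv_seq n := iter n psinv_step [::].
Definition psinv n := (psinv_seq n.+1)`_n.

Lemma size_psinv_seq n : size (psinv_seq n) = n.
Proof. by elim: n => //= n IHn; rewrite size_rcons IHn. Qed.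

Lemma nth_psinv_seq n i : (i < n)%N -> (psinv_seq n)`_i = psinv i.
Proof.
elim: n => // n IHn; rewrite ltnS leq_eqVlt => /orP[/eqP -> //|i_n].
by rewrite /= nth_rcons size_psinv_seq i_n IHn.
Qed.

Lemma psinvP n : \sum_(i < n.+1) psinv i * p (n - i) = (n == 0)%:R.
Proof.
rewrite big_ord_recr /= subnn {2}/psinv /= nth_rcons size_psinv_seq ltnn eqxx.
rewrite mulrAC mulVf // mul1r addrC.
rewrite [X in _ + X](eq_bigr (fun i : 'I_n => (psinv_seq n)`_i * p (n - i))) ?subrK // => i _.
by rewrite nth_psinv_seq.
Qed.
End PowerSeriesInverse.

Lemma laurent_inv_ex f : f != 0 -> exists g, g * f = 1.
Proof.
case/laurent_order => M fM0 fM; pose p i := f (M + i%:Z).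
have p0 : p 0 != 0 by rewrite /p addr0.
pose c (m : int) := if 0 <= m + M then psinv p (absz (m + M)%R) else 0.
have cM : lbelow c (- M) by move=> n nM; rewrite /c ifF //; lia.
have exc : exists N, lbelow c N by exists (- M).
exists (Laurent exc); apply: (@laurent_shiftP _ _ 0).
- by rewrite -(addNr M); apply: lmulc_below.
- by move=> n n0; rewrite lcoef1 lt_eqF.
move=> n; have := @lmulcE (Laurent exc) f _ _ n cM fM; rewrite addNr => E.
rewrite [LHS]E lcoef1 add0r.
transitivity ((n == 0)%:R : F); last by case: (n).
rewrite -(psinvP p0); apply: eq_bigr => i _ /=; congr (_ * _).
by rewrite /c; case: ifP => [_|]; [congr psinv|]; lia.
Qed.

Definition linv f : laurent F := xget 0 [set g | g * f = 1].

Lemma lmulVf f : f != 0 -> linv f * f = 1.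
Proof. by move=> /laurent_inv_ex; exact: xgetPex. Qed.

Lemma linv0 : linv 0 = 0.
Proof.
apply: xgetPN => g /= /eqP.
by rewrite mulr0 eq_sym oner_eq0.
Qed.

HB.instance Definition _ := GRing.ComNzRing_isField.Build (laurent F) lmulVf linv0.

Lemma laurentC_is_additive : zmod_morphism laurentC.
Proof. by move=> a b; apply/laurentP => n /=; case: eqP => // _; rewrite subr0. Qed.

Lemma laurentC_is_multiplicative : monoid_morphism laurentC.
Proof.
split=> // a b.
have bC c : lbelow (laurentC c) 0 by move=> n n0 /=; rewrite lt_eqF.
apply: (@laurent_shiftP _ _ 0) => //; first by rewrite -[0]addr0; apply: lmulc_below.
move=> n; have := lmulcE n (bC a) (bC b); rewrite addr0 => E.
rewrite [RHS]E big_ord_recl big1 => [|i _] /=.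
  by rewrite addr0 subn0 add0r; case: eqP; rewrite ?mulr0.
by rewrite mul0r.
Qed.

HB.instance Definition _ :=
  GRing.isZmodMorphism.Build F (laurent F) laurentC laurentC_is_additive.
HB.instance Definition _ :=
  GRing.isMonoidMorphism.Build F (laurent F) laurentC laurentC_is_multiplicative.

End Laurent.

Arguments laurentX {F}.

(* The inclusion of F in L = F((t1))((t2)) = laurent (laurent F), whose inner
   variable is t1 and whose outer variable is t2.                             *)
Definition laurent2C (F : fieldType) : {rmorphism F -> laurent (laurent F)} :=
  @laurentC (laurent F) \o @laurentC F.

Definition t1 (F : fieldType) : laurent (laurent F) := laurentC laurentX.
Definition t2 (F : fieldType) : laurent (laurent F) := laurentX.

(* quat a b is the quaternion algebra (a,b)_K, with Quat x0 x1 x2 x3 standing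
   for x0 + x1 i + x2 j + x3 ij; see quat_presentation.                       *)
Record quat (K : fieldType) (a b : K) := Quat { q0 : K; q1 : K; q2 : K; q3 : K }.

Section Quaternion.
Variables (K : fieldType) (a b : K).
Local Notation quat := (quat a b).
Local Notation Quat := (@Quat K a b).
Implicit Types x y z : quat.

Definition quat_tuple x := (q0 x, q1 x, q2 x, q3 x).
Definition tuple_quat (u : K * K * K * K) :=
  Quat u.1.1.1 u.1.1.2 u.1.2 u.2.
Lemma quat_tupleK : cancel quat_tuple tuple_quat. Proof. by case. Qed.
HB.instance Definition _ := Choice.copy quat (can_type quat_tupleK).

Definition qadd x y := Quat (q0 x + q0 y) (q1 x + q1 y) (q2 x + q2 y) (q3 x + q3 y).
Definition qopp x := Quat (- q0 x) (- q1 x) (- q2 x) (- q3 x).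
Definition qscale (c : K) x := Quat (c * q0 x) (c * q1 x) (c * q2 x) (c * q3 x).
Definition qmul x y := Quat
  (q0 x * q0 y + a * q1 x * q1 y + b * q2 x * q2 y - a * b * q3 x * q3 y)
  (q0 x * q1 y + q1 x * q0 y - b * q2 x * q3 y + b * q3 x * q2 y)
  (q0 x * q2 y + q2 x * q0 y + a * q1 x * q3 y - a * q3 x * q1 y)
  (q0 x * q3 y + q3 x * q0 y + q1 x * q2 y - q2 x * q1 y).

Fact qaddA : associative qadd.
Proof. by move=> x y z; rewrite /qadd /= !addrA. Qed.
Fact qaddC : commutative qadd.
Proof. by move=> x y; congr Quat; rewrite addrC. Qed.
Fact qadd0 : left_id (Quat 0 0 0 0) qadd.
Proof. by case=> *; rewrite /qadd /= !add0r. Qed.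
Fact qaddN : left_inverse (Quat 0 0 0 0) qopp qadd.
Proof. by move=> x; rewrite /qadd /= !addNr. Qed.
HB.instance Definition _ := GRing.isZmodule.Build quat qaddA qaddC qadd0 qaddN.

Fact qmulA : associative qmul.
Proof. by move=> x y z; congr Quat; rewrite /=; ring. Qed.
Fact qmul1 : left_id (Quat 1 0 0 0) qmul.
Proof. by case=> *; congr Quat; rewrite /=; ring. Qed.
Fact q1mul : right_id (Quat 1 0 0 0) qmul.
Proof. by case=> *; congr Quat; rewrite /=; ring. Qed.
Fact qmulDl : left_distributive qmul qadd.
Proof. by move=> x y z; congr Quat; rewrite /=; ring. Qed.
Fact qmulDr : right_distributive qmul qadd.
Proof. by move=> x y z; congr Quat; rewrite /=; ring. Qed.
Fact quat1_neq0 : Quat 1 0 0 0 != 0.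
Proof. by apply/eqP => -[/eqP]; rewrite oner_eq0. Qed.
HB.instance Definition _ := GRing.Zmodule_isNzRing.Build quat
  qmulA qmul1 q1mul qmulDl qmulDr quat1_neq0.

Fact qscaleA c d x : qscale c (qscale d x) = qscale (c * d) x.
Proof. by rewrite /qscale /= !mulrA. Qed.
Fact qscale1 : left_id 1 qscale.
Proof. by case=> *; rewrite /qscale /= !mul1r. Qed.
Fact qscaleDr : right_distributive qscale +%R.
Proof. by move=> c x y; congr Quat; rewrite /= mulrDr. Qed.
Fact qscaleDl x : {morph qscale^~ x : c d / c + d}.
Proof. by move=> c d; congr Quat; rewrite /= mulrDl. Qed.
HB.instance Definition _ := GRing.Zmodule_isLmodule.Build K quat
  qscaleA qscale1 qscaleDr qscaleDl.

Fact qscaleAl (c : K) x y : c *: (x * y) = (c *: x) * y.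
Proof. by congr Quat; rewrite /=; ring. Qed.
HB.instance Definition _ := GRing.Lmodule_isLalgebra.Build K quat qscaleAl.
Fact qscaleAr (c : K) x y : c *: (x * y) = x * (c *: y).
Proof. by congr Quat; rewrite /=; ring. Qed.
HB.instance Definition _ := GRing.Lalgebra_isAlgebra.Build K quat qscaleAr.

Definition quat_i : quat := Quat 0 1 0 0.
Definition quat_j : quat := Quat 0 0 1 0.

Lemma quat_ii : quat_i ^+ 2 = a%:A.
Proof. by rewrite expr2; congr Quat; rewrite /=; ring. Qed.
Lemma quat_jj : quat_j ^+ 2 = b%:A.
Proof. by rewrite expr2; congr Quat; rewrite /=; ring. Qed.
Lemma quat_ij : quat_i * quat_j = - (quat_j * quat_i).
Proof. by congr Quat; rewrite /=; ring. Qed.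
Lemma quatE x :
  x = (q0 x)%:A + q1 x *: quat_i + q2 x *: quat_j + q3 x *: (quat_i * quat_j).
Proof. by case: x => *; congr Quat; rewrite /=; ring. Qed.

(* quat a b is generated by i and j subject only to i^2 = a, j^2 = b, ij = -ji. *)
Lemma quat_presentation (C : algType K) (u v : C) :
    u ^+ 2 = a%:A -> v ^+ 2 = b%:A -> u * v = - (v * u) ->
  exists f : {lrmorphism quat -> C}, [/\ f quat_i = u, f quat_j = v &
    forall g : {lrmorphism quat -> C}, g quat_i = u -> g quat_j = v -> g =1 f].
Proof.
rewrite !expr2 => uu vv uv.
pose f x := (q0 x)%:A + q1 x *: u + q2 x *: v + q3 x *: (u * v).
have fB : zmod_morphism f.
  move=> x y; rewrite /f /= !scalerDl !scaleNr !opprD [RHS]addrACA; congr (_ + _).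
  by rewrite [RHS]addrACA; congr (_ + _); rewrite addrACA.
have fZ : scalable f by move=> c x; rewrite /f /= !scalerDr !scalerA.
have f1 : f 1 = 1 by rewrite /f /= !scale0r !addr0 scale1r.
pose f' : {linear quat -> C} := HB.pack f (GRing.isZmodMorphism.Build _ _ f fB)
  (GRing.isScalable.Build _ _ _ _ f fZ).
have fi y : f (quat_i * y) = u * f y.
  have -> : quat_i * y = Quat (a * q1 y) (q0 y) (a * q3 y) (q2 y).
    by congr Quat; rewrite /=; ring.
  rewrite /f /= !mulrDr -!scalerAr mulr1 mulrA uu -scalerAl mul1r !scalerA.
  by rewrite [q1 y * a]mulrC [q3 y * a]mulrC [RHS](ACl (2*1*4*3))%AC.
have fj y : f (quat_j * y) = v * f y.
  have -> : quat_j * y = Quat (b * q2 y) (- b * q3 y) (q0 y) (- q1 y).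
    by congr Quat; rewrite /=; ring.
  rewrite /f /= !mulrDr -!scalerAr mulr1 vv mulrA.
  have -> : v * u = - (u * v) by rewrite uv opprK.
  rewrite [- (u * v) * v]mulNr -mulrA vv -scalerAr mulr1 !scalerN -!scaleNr !scalerA.
  rewrite !mulNr [q3 y * b]mulrC [q2 y * b]mulrC.
  by rewrite [RHS](ACl (3*4*1*2))%AC.
have fM x y : f (x * y) = f x * f y.
  rewrite {1}[x]quatE !mulrDl -!scalerAl mul1r -mulrA.
  rewrite -[f _]/(f' _) !linearD !linearZ /= fi fj fi fj.
  by rewrite mul1r mulrA.
pose F' : {lrmorphism quat -> C} := HB.pack f (GRing.isZmodMorphism.Build _ _ f fB)
  (GRing.isScalable.Build _ _ _ _ f fZ)
  (GRing.isMonoidMorphism.Build _ _ f (conj f1 fM)).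
exists F'; split=> [||g gi gj x] /=.
- by rewrite /f /= !scale0r scale1r !addr0 add0r.
- by rewrite /f /= !scale0r scale1r !addr0 add0r.
- by rewrite {1}[x]quatE !linearD !linearZ /= rmorph1 rmorphM /= gi gj.
Qed.
End Quaternion.

Definition quaternion_subalgebra (K : fieldType) (A : algType K) (Q : set A) :=
  exists a b : K, [/\ a != 0, b != 0 &
    exists2 f : {lrmorphism quat a b -> A}, injective f & Q = range f].

(* tensor D iota B is the L-algebra obtained by tensoring over F the F-algebra D
   with the L-algebra B, the latter being an F-algebra through iota : F -> L.
   The function u encodes the sum of the e_k (x) u_k, where e is the chosen
   basis of D; see tensor_universal.                                          *)
Definition tensor (F : fieldType) (D : falgType F) (L : fieldType)
    (iota : {rmorphism F -> L}) (B : algType L) : Type :=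
  {ffun 'I_(\dim {:D}) -> B}.

Section Tensor.
Variables (F : fieldType) (D : falgType F) (L : fieldType).
Variables (iota : {rmorphism F -> L}) (B : algType L).
Local Notation T := (tensor D iota B).
Local Notation n := (\dim {:D}).
Local Notation e := (vbasis {:D}).
Implicit Types (d : D) (b : B) (u v w : T).

HB.instance Definition _ := GRing.Lmodule.copy T {ffun 'I_(\dim {:D}) -> B}.

Definition tens d b : T := [ffun k => iota (coord e k d) *: b].

Lemma tensDl d d' b : tens (d + d') b = tens d b + tens d' b.
Proof. by apply/ffunP => k; rewrite !ffunE linearD rmorphD scalerDl. Qed.
Lemma tensDr d b b' : tens d (b + b') = tens d b + tens d b'.
Proof. by apply/ffunP => k; rewrite !ffunE scalerDr. Qed.
Lemma tensZl c d b : tens (c *: d) b = iota c *: tens d b.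
Proof. by apply/ffunP => k; rewrite !ffunE linearZ rmorphM scalerA. Qed.
Lemma tensZr c d b : tens d (c *: b) = c *: tens d b.
Proof. by apply/ffunP => k; rewrite !ffunE !scalerA mulrC. Qed.
Lemma tens0l b : tens 0 b = 0.
Proof. by rewrite -(scale0r 0) tensZl rmorph0 scale0r. Qed.
Lemma tens0r d : tens d 0 = 0.
Proof. by rewrite -(scale0r 0) tensZr scale0r. Qed.
Lemma tens_suml I (r : seq I) (P : pred I) (E : I -> D) b :
  tens (\sum_(i <- r | P i) E i) b = \sum_(i <- r | P i) tens (E i) b.
Proof. by apply: (big_morph (tens^~ b)) => [d d'|]; rewrite ?tensDl ?tens0l. Qed.

Lemma coord_e d : d = \sum_(i < n) coord e i d *: e`_i.
Proof. exact/coord_vbasis/memvf. Qed.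

Lemma tensE u : u = \sum_(i < n) tens e`_i (u i).
Proof.
apply/ffunP => k; rewrite sum_ffunE (bigD1 k) //= big1 => [|i ik].
  by rewrite ffunE coord_free ?(basis_free (vbasisP _)) // eqxx rmorph1 scale1r addr0.
rewrite ffunE coord_free ?(basis_free (vbasisP _)) //.
by rewrite (negPf ik) rmorph0 scale0r.
Qed.

Lemma tens_ind (P : T -> Prop) :
    (forall d b, P (tens d b)) -> (forall u v, P u -> P v -> P (u + v)) ->
  forall u, P u.
Proof.
move=> Pt PD u; rewrite [u]tensE; apply: big_ind => //.
by rewrite -(tens0l 0).
Qed.

Definition tmul u v : T := \sum_(i < n) \sum_(j < n) tens (e`_i * e`_j) (u i * v j).

Lemma tmulDl : left_distributive tmul +%R.
Proof.
move=> u v w; rewrite /tmul -big_split; apply: eq_bigr => i _ /=.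
by rewrite -big_split; apply: eq_bigr => j _; rewrite ffunE mulrDl tensDr.
Qed.
Lemma tmulDr : right_distributive tmul +%R.
Proof.
move=> u v w; rewrite /tmul -big_split; apply: eq_bigr => i _ /=.
by rewrite -big_split; apply: eq_bigr => j _; rewrite ffunE mulrDr tensDr.
Qed.

Lemma tmul_tens d d' b b' : tmul (tens d b) (tens d' b') = tens (d * d') (b * b').
Proof.
rewrite {2}[d]coord_e mulr_suml tens_suml; apply: eq_bigr => i _.
rewrite {2}[d']coord_e mulr_sumr tens_suml; apply: eq_bigr => j _.
by rewrite !ffunE -scalerAl -!scalerAr -scalerAl !tensZr !tensZl !scalerA mulrC.
Qed.

Lemma tmulA : associative tmul.
Proof.
move=> u v w.
elim/tens_ind: u => [d b|u u' IHu IHu']; last by rewrite !tmulDl IHu IHu'.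
elim/tens_ind: v => [d' b'|v v' IHv IHv']; last by rewrite !(tmulDl, tmulDr) IHv IHv'.
elim/tens_ind: w => [d'' b''|w w' IHw IHw']; last by rewrite !tmulDr IHw IHw'.
by rewrite !tmul_tens !mulrA.
Qed.
Lemma tmul1 : left_id (tens 1 1) tmul.
Proof.
move=> u; elim/tens_ind: u => [d b|u v IHu IHv]; last by rewrite tmulDr IHu IHv.
by rewrite tmul_tens !mul1r.
Qed.
Lemma t1mul : right_id (tens 1 1) tmul.
Proof.
move=> u; elim/tens_ind: u => [d b|u v IHu IHv]; last by rewrite tmulDl IHu IHv.
by rewrite tmul_tens !mulr1.
Qed.
Lemma tens11_neq0 : tens 1 1 != 0.
Proof.
apply: contra_neq (oner_neq0 D) => /ffunP t0; rewrite [LHS]coord_e big1 // => i _.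
have /eqP := t0 i; rewrite !ffunE scaler_eq0 oner_eq0 orbF fmorph_eq0 => /eqP ->.
by rewrite scale0r.
Qed.

HB.instance Definition _ := GRing.Zmodule_isNzRing.Build T
  tmulA tmul1 t1mul tmulDl tmulDr tens11_neq0.

Lemma tensM d d' b b' : tens d b * tens d' b' = tens (d * d') (b * b').
Proof. exact: tmul_tens. Qed.
Lemma tens1 : tens 1 1 = 1. Proof. by []. Qed.

Fact tscaleAl (c : L) u v : c *: (u * v) = (c *: u) * v.
Proof.
elim/tens_ind: u => [d b|u u' IHu IHu'].
  elim/tens_ind: v => [d' b'|v v' IHv IHv']; last by rewrite !mulrDr scalerDr IHv IHv'.
  by rewrite -tensZr !tensM -tensZr scalerAl.
by rewrite scalerDr !mulrDl scalerDr IHu IHu'.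
Qed.
HB.instance Definition _ := GRing.Lmodule_isLalgebra.Build L T tscaleAl.
Fact tscaleAr (c : L) u v : c *: (u * v) = u * (c *: v).
Proof.
elim/tens_ind: u => [d b|u u' IHu IHu'].
  elim/tens_ind: v => [d' b'|v v' IHv IHv'].
    by rewrite -tensZr !tensM -tensZr scalerAr.
  by rewrite scalerDr !mulrDr scalerDr IHv IHv'.
by rewrite !mulrDl scalerDr IHu IHu'.
Qed.
HB.instance Definition _ := GRing.Lalgebra_isAlgebra.Build L T tscaleAr.

Lemma tensor_universal (C : algType L) (f : {lrmorphism D -> C | iota \; *:%R})
    (g : {lrmorphism B -> C}) : (forall d b, f d * g b = g b * f d) ->
  exists h : {lrmorphism T -> C}, (forall d b, h (tens d b) = f d * g b) /\
    forall h' : {lrmorphism T -> C},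
      (forall d b, h' (tens d b) = f d * g b) -> h' =1 h.
Proof.
move=> fg; pose h u := \sum_(i < n) f e`_i * g (u i).
have hB : zmod_morphism h.
  move=> u v; rewrite /h -sumrB; apply: eq_bigr => i _.
  by rewrite !ffunE raddfB mulrBr.
have hZ : scalable h.
  move=> c u; rewrite /h scaler_sumr; apply: eq_bigr => i _.
  by rewrite ffunE linearZ /= scalerAr.
have ht d b : h (tens d b) = f d * g b.
  rewrite {2}[d]coord_e linear_sum mulr_suml; apply: eq_bigr => i _.
  by rewrite ffunE !linearZ /= -scalerAr scalerAl.
have hD : {morph h : u v / u + v}.
  move=> u v; rewrite /h -big_split; apply: eq_bigr => i _ /=.
  by rewrite ffunE raddfD mulrDr.
have h1 : h 1 = 1 by rewrite -tens1 ht !rmorph1 mulr1.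
have hM : {morph h : u v / u * v}.
  move=> u v; elim/tens_ind: u => [d b|u u' IHu IHu'].
    elim/tens_ind: v => [d' b'|v v' IHv IHv']; last by rewrite mulrDr !hD IHv IHv' mulrDr.
    by rewrite tensM !ht !rmorphM /= -!mulrA; congr (_ * _); rewrite !mulrA fg.
  by rewrite mulrDl !hD IHu IHu' mulrDl.
pose H : {lrmorphism T -> C} := HB.pack h (GRing.isZmodMorphism.Build _ _ h hB)
  (GRing.isScalable.Build _ _ _ _ h hZ)
  (GRing.isMonoidMorphism.Build _ _ h (conj h1 hM)).
exists H; split=> // h' h't u; elim/tens_ind: u => [d b|u v IHu IHv].
  by rewrite h't [RHS]ht.
by rewrite !raddfD /= IHu IHv.
Qed.
End Tensor.

Arguments tens {F D L} iota {B} d b.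

(* Main.v *)
(* Write y = y0 + y1 i + y2 j + y3 ij with y_k in D((t1))((t2)). If a quaternion
   L-subalgebra contains x, it contains some y with xy = -yx and y^2 in L^*, and
   comparing scalar parts gives y0^2 + t1 y1^2 + t2 y2^2 - t1 t2 y3^2 = y^2.
   For the lexicographic order on exponents of t2 and t1, the leading term of
   y_k^2 is the square of that of y_k since D is a division algebra, so the four
   summands have leading exponents in distinct classes modulo 2 and cannot cancel.
   Hence, up to sign, the leading coefficient of y^2 is d^2 where d in D is the
   leading coefficient of some y_k: d^2 is in F^*, and xd = -dx because x commutes
   with i, j, t1 and t2. Then x and d generate a quaternion F-subalgebra of D. *)
Require Import Defs.
From mathcomp Require Import all_boot all_order all_algebra all_field.
From mathcomp Require Import boolp classical_sets.
From mathcomp Require Import zify ring.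

Set Implicit Arguments.
Unset Strict Implicit.
Unset Printing Implicit Defensive.
Import Order.TTheory GRing.Theory Num.Theory.
Local Open Scope ring_scope.

Section LaurentCoefficients.
Variable K : fieldType.
Implicit Types (f g : laurent K) (c : K).

Lemma lcoef_mul_lead f g (M N : int) :
  lbelow f M -> lbelow g N -> (f * g) (M + N) = f M * g N.
Proof.
move=> fM gN; rewrite lcoefM -[M + N]addr0 (@lmulcE _ f g M N 0 fM gN).
by rewrite big_ord1 /= !addr0.
Qed.

Lemma lcoefXM f n : (laurentX * f) n = f (n - 1).
Proof.
have [N fN] := lcoef_bounded f; rewrite lcoefM.
have X1 : lbelow (@laurentX K) 1.
  by move=> m m1 /=; rewrite (_ : (m == 1) = false) //; lia.
have [nN|Nn] := ltP n (1 + N).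
  by rewrite (lmulc_below X1 fN) // fN //; lia.
have -> : n = 1 + N + (absz (n - (1 + N))%R)%:Z by lia.
rewrite (lmulcE _ X1 fN) big_ord_recl big1 => [|i _] /=.
  by rewrite addr0 mul1r; congr (lcoef f _); lia.
by rewrite mul0r.
Qed.

Lemma lcoefCM c f n : (laurentC c * f) n = c * f n.
Proof.
have [N fN] := lcoef_bounded f; rewrite lcoefM.
have C0 : lbelow (laurentC c) 0 by move=> m m0 /=; rewrite lt_eqF.
have [nN|Nn] := ltP n N.
  by rewrite -[N]add0r in nN; rewrite (lmulc_below C0 fN) // fN ?mulr0 //; lia.
have -> : n = 0 + N + `|n - N|%N%:Z by lia.
rewrite (lmulcE _ C0 fN) big_ord_recl big1 => [|i _] /=.
  by rewrite addr0; congr (_ * lcoef f _); lia.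
by rewrite mul0r.
Qed.

Lemma laurent_family_order n (f : 'I_n -> laurent K) :
    (exists k, f k != 0) ->
  exists2 M, (forall k, lbelow (f k) M) & exists k, f k M != 0.
Proof.
case=> k0 fk0.
have [N fN] : exists N : int, forall k, lbelow (f k) N.
  pose b k := xget 0 [set N : int | lbelow (f k) N]%classic.
  have bP k : lbelow (f k) (b k).
    by apply: (@xgetPex _ 0 [set N | lbelow (f k) N]%classic); exact: lcoef_bounded.
  exists (- (\sum_k `|b k|%N)%N%:Z) => k m mb; apply: bP.
  have : (`|b k| <= \sum_k `|b k|)%N by rewrite (bigD1 k) //= leq_addr.
  lia.
have exm : exists m : nat, [exists k, f k (N + m%:Z) != 0].
  have [M fM _] := laurent_order fk0.
  have [/fN|NM] := ltP M N; first by move=> f0; rewrite f0 eqxx in fM.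
  exists `|M - N|%N; apply/existsP; exists k0.
  by have <- : M = N + `|M - N|%N%:Z by lia.
case: (ex_minnP exm) => m /existsP[k fk] min_m; exists (N + m%:Z); last by exists k.
move=> j l lm; have [/fN //|Nl] := ltP l N.
have E : l = N + `|l - N|%N%:Z by lia.
rewrite E; apply/eqP/negPn/negP => fl.
have /min_m : [exists k, f k (N + `|l - N|%N%:Z) != 0] by apply/existsP; exists j.
lia.
Qed.
End LaurentCoefficients.

Definition lexbelow (V : nmodType) (G : int -> int -> V) (m p : int) :=
  forall s r, (s < m) || ((s == m) && (r < p)) -> G s r = 0.

Definition lcoef2 (F : fieldType) (f : laurent (laurent F)) (s r : int) : F := f s r.

Section IteratedLaurentCoefficients.
Variable F : fieldType.
Local Notation L := (laurent (laurent F)).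
Implicit Types f g : L.

Lemma lcoef_t2M f s r : (t2 F * f) s r = f (s - 1) r.
Proof. by rewrite lcoefXM. Qed.

Lemma lcoef_t1M f s r : (t1 F * f) s r = f s (r - 1).
Proof. by rewrite lcoefCM lcoefXM. Qed.

Lemma lcoef_norm_form f0 f1 f2 f3 s r :
  (f0 + t1 F * f1 + t2 F * f2 - t1 F * (t2 F * f3)) s r =
  f0 s r + f1 s (r - 1) + f2 (s - 1) r - f3 (s - 1) (r - 1).
Proof.
by rewrite -(lcoef_t1M f1) -(lcoef_t2M f2) -(lcoef_t2M f3) -(lcoef_t1M (t2 F * f3)).
Qed.

Lemma lcoef_constM (a : F) f s r : (laurent2C F a * f) s r = a * f s r.
Proof. by rewrite !lcoefCM. Qed.

Lemma lexbelowP f m p : lexbelow (lcoef2 f) m p -> lbelow f m /\ lbelow (f m) p.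
Proof.
move=> fb; split=> [s sm|r rp]; last by apply: fb; rewrite eqxx rp orbT.
by apply: laurentP => r; rewrite lcoef0; apply: fb; rewrite sm.
Qed.

Lemma lexbelowM f g m p m' p' :
    lexbelow (lcoef2 f) m p -> lexbelow (lcoef2 g) m' p' ->
  lexbelow (lcoef2 (f * g)) (m + m') (p + p') /\
  (f * g) (m + m') (p + p') = f m p * g m' p'.
Proof.
move=> /lexbelowP[f1 f2] /lexbelowP[g1 g2]; have fg := lcoef_mul_lead f1 g1.
split; last by rewrite fg lcoef_mul_lead.
move=> s r /orP[sm|/andP[/eqP -> rp]].
  by rewrite /lcoef2 [(f * g) s](lmulc_below f1 g1) // lcoef0.
by rewrite /lcoef2 fg [LHS](lmulc_below f2 g2).
Qed.

Lemma iterated_laurent_family_order n (f : 'I_n -> L) :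
    (exists k, f k != 0) ->
  exists m p, (forall k, lexbelow (lcoef2 (f k)) m p) /\ exists k, f k m p != 0.
Proof.
move=> /laurent_family_order[m fm] /laurent_family_order[p fp fmp].
exists m, p; split=> // k s r; rewrite /lcoef2 => /orP[/fm ->|/andP[/eqP ->]].
  exact: lcoef0.
exact: fp.
Qed.
End IteratedLaurentCoefficients.

Section LeadingSquares.
Variables (F : fieldType) (D : falgType F).
Local Notation L := (laurent (laurent F)).
Local Notation e := (vbasis {:D}).
Local Notation n := (\dim {:D}).

(* A family of n elements of L stands for an element of D((t1))((t2)) by its
   coordinates on the basis e of D; famcoef and famprod give the coefficients
   in D of such an element and of a product of two of them.                   *)
Definition famcoef (f : 'I_n -> L) (s r : int) : D :=
  \sum_(i < n) f i s r *: e`_i.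

Definition famprod (f g : 'I_n -> L) (s r : int) : D :=
  \sum_(i < n) \sum_(j < n) (f i * g j) s r *: (e`_i * e`_j).

Lemma famcoef_eq0 f s r : famcoef f s r = 0 -> forall k, f k s r = 0.
Proof.
have /freeP e_free := basis_free (vbasisP {:D}).
exact: (e_free (fun k => f k s r)).
Qed.

Lemma famprod_lead f g m p m' p' :
    (forall k, lexbelow (lcoef2 (f k)) m p) ->
    (forall k, lexbelow (lcoef2 (g k)) m' p') ->
  lexbelow (famprod f g) (m + m') (p + p') /\
  famprod f g (m + m') (p + p') = famcoef f m p * famcoef g m' p'.
Proof.
move=> fb gb; split=> [s r sr|].
  apply: big1 => i _; apply: big1 => j _.
  by have := (lexbelowM (fb i) (gb j)).1 s r sr; rewrite /lcoef2 => ->; apply: scale0r.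
rewrite mulr_suml; apply: eq_bigr => i _; rewrite mulr_sumr; apply: eq_bigr => j _.
by rewrite (lexbelowM (fb i) (gb j)).2 -scalerAl -scalerAr scalerA.
Qed.

Variable P : D -> Prop.
Implicit Types (C : int -> int -> bool) (G : int -> int -> D).

Definition lead_square C G :=
  (forall s r, G s r = 0) \/
  exists m p d, [/\ lexbelow G m p, C m p, d != 0, P d &
    G m p = d * d \/ G m p = - (d * d)].

Lemma lead_squareN C G : lead_square C G -> lead_square C (fun s r => - G s r).
Proof.
case=> [G0|[m [p [d [Gb Cmp d0 Pd Gd]]]]]; [left=> s r|right].
  by rewrite G0 oppr0.
exists m, p, d; split=> // [s r /Gb ->|]; first by rewrite oppr0.
by case: Gd => ->; [right|left]; rewrite ?opprK.
Qed.

Lemma lead_squareD C C' G G' : (forall m p, C m p -> ~~ C' m p) ->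
    lead_square C G -> lead_square C' G' ->
  lead_square (fun m p => C m p || C' m p) (fun s r => G s r + G' s r).
Proof.
move=> CC' [G0|[m [p [d [Gb Cmp d0 Pd Gd]]]]].
  case=> [G'0|[m [p [d [Gb Cmp d0 Pd Gd]]]]]; [left=> s r|right].
    by rewrite G0 G'0 addr0.
  exists m, p, d; split=> // [s r /Gb ->||].
  - by rewrite G0 addr0.
  - by rewrite Cmp orbT.
  - by rewrite G0 add0r.
case=> [G'0|[m' [p' [d' [Gb' Cmp' d'0 Pd' Gd']]]]]; right.
  exists m, p, d; split=> // [s r /Gb ->||].
  - by rewrite G'0 addr0.
  - by rewrite Cmp.
  - by rewrite G'0 addr0.
have [lt|ge] := boolP ((m < m') || ((m == m') && (p < p'))).
  exists m, p, d; split=> // [s r sr||].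
  - by rewrite Gb // Gb' ?addr0 //; lia.
  - by rewrite Cmp.
  - by rewrite Gb' // addr0.
have lt : (m' < m) || ((m' == m) && (p' < p)).
  have /implyP := CC' m p; rewrite Cmp /= => nC'.
  have : ~~ ((m == m') && (p == p')).
    by apply: contra nC' => /andP[/eqP -> /eqP ->].
  lia.
exists m', p', d'; split=> // [s r sr||].
- by rewrite Gb ?Gb' ?addr0 //; lia.
- by rewrite Cmp' orbT.
- by rewrite Gb // add0r.
Qed.

Lemma lead_square_famprod C (f : 'I_n -> L) (a b : int) :
    (forall s r, P (famcoef f s r)) -> (forall m p, C (m + m + a) (p + p + b)) ->
  lead_square C (fun s r => famprod f f (s - a) (r - b)).
Proof.
move=> Pf Cab; have [/existsP/iterated_laurent_family_order|f0] :=
    boolP [exists k, f k != 0].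
  case=> m [p [fb [k fk]]]; have [b2 c2] := famprod_lead fb fb.
  right; exists (m + m + a), (p + p + b), (famcoef f m p); split=> //.
  - by move=> s r sr; apply: b2; lia.
  - by apply: contra fk => /eqP/famcoef_eq0 ->.
  - by left; rewrite !addrK.
left=> s r; apply: big1 => i _; apply: big1 => j _.
move: f0; rewrite negb_exists => /forallP/(_ i)/negPn/eqP ->.
by rewrite mul0r !lcoef0 scale0r.
Qed.
End LeadingSquares.

Section TensorCoefficients.
Variables (F : fieldType) (D : falgType F).
Local Notation L := (laurent (laurent F)).
Local Notation iota := (laurent2C F).
Local Notation A := (tensor D iota (quat (t1 F) (t2 F))).
Local Notation e := (vbasis {:D}).
Local Notation n := (\dim {:D}).
Implicit Types u v : A.

Let Q := quat (t1 F) (t2 F).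

Definition tcoef (q : Q -> L) u : int -> int -> D := famcoef (fun k => q (u k)).

Section Additive.
Variable q : Q -> L.
Hypotheses (qD : {morph q : x y / x + y}) (qZ : forall c x, q (c *: x) = c * q x).

Lemma tcoefD u v s r : tcoef q (u + v) s r = tcoef q u s r + tcoef q v s r.
Proof.
by rewrite -big_split; apply: eq_bigr => i _ /=; rewrite ffunE qD -scalerDl.
Qed.

Lemma tcoef0 s r : tcoef q 0 s r = 0.
Proof. by apply: (addIr (tcoef q 0 s r)); rewrite -tcoefD !add0r. Qed.

Lemma tcoef_tens d b s r : tcoef q (tens iota d b) s r = q b s r *: d.
Proof.
rewrite {2}[d]coord_e scaler_sumr; apply: eq_bigr => i _.
by rewrite ffunE qZ lcoef_constM mulrC scalerA.
Qed.

Lemma tcoefMl d u s r : tcoef q (tens iota d 1 * u) s r = d * tcoef q u s r.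
Proof.
elim/tens_ind: u => [d' b|u v IHu IHv]; last first.
  by rewrite mulrDr !tcoefD [RHS]mulrDr; congr (_ + _).
by rewrite tensM mul1r !tcoef_tens -scalerAr.
Qed.

Lemma tcoefMr d u s r : tcoef q (u * tens iota d 1) s r = tcoef q u s r * d.
Proof.
elim/tens_ind: u => [d' b|u v IHu IHv]; last first.
  by rewrite mulrDl !tcoefD [RHS]mulrDl; congr (_ + _).
by rewrite tensM mulr1 !tcoef_tens -scalerAl.
Qed.

Lemma tcoef_anticomm d u s r : tens iota d 1 * u = - (u * tens iota d 1) ->
  d * tcoef q u s r = - (tcoef q u s r * d).
Proof.
move=> du; apply/eqP; rewrite -addr_eq0 -tcoefMl -tcoefMr -tcoefD du addNr.
by rewrite tcoef0.
Qed.

Lemma tcoefM u v s r : tcoef q (u * v) s r =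
  \sum_(i < n) \sum_(j < n) q (u i * v j) s r *: (e`_i * e`_j).
Proof.
have tsum (I : finType) (E : I -> A) :
    tcoef q (\sum_i E i) s r = \sum_i tcoef q (E i) s r.
  by apply: (big_morph (fun w => tcoef q w s r)) => [w w'|]; rewrite ?tcoefD ?tcoef0.
rewrite [u * v]/(tmul u v) tsum; apply: eq_bigr => i _.
by rewrite tsum; apply: eq_bigr => j _; rewrite tcoef_tens.
Qed.
End Additive.

Lemma tcoef_q0_sqr u s r : let y (q : Q -> L) k := q (u k) in
  tcoef (@q0 _ _ _) (u * u) s r =
    famprod (y (@q0 _ _ _)) (y (@q0 _ _ _)) (s - 0) (r - 0)
    + famprod (y (@q1 _ _ _)) (y (@q1 _ _ _)) (s - 0) (r - 1)
    + famprod (y (@q2 _ _ _)) (y (@q2 _ _ _)) (s - 1) (r - 0)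
    - famprod (y (@q3 _ _ _)) (y (@q3 _ _ _)) (s - 1) (r - 1).
Proof.
have q0M (a b : Q) : q0 (a * b) s r = (q0 a * q0 b) s r + (q1 a * q1 b) s (r - 1)
    + (q2 a * q2 b) (s - 1) r - (q3 a * q3 b) (s - 1) (r - 1).
  have -> : q0 (a * b) = q0 a * q0 b + t1 F * (q1 a * q1 b)
      + t2 F * (q2 a * q2 b) - t1 F * (t2 F * (q3 a * q3 b)).
    by rewrite !mulrA.
  exact: lcoef_norm_form.
move=> y; rewrite tcoefM // !subr0 -sumrN -!big_split.
apply: eq_bigr => i _; cbv beta; rewrite -sumrN -!big_split.
by apply: eq_bigr => j _; rewrite q0M !scalerDl scaleNr.
Qed.

Lemma tcoef_scalar (l : L) s r : tcoef (@q0 _ _ _) (l%:A : A) s r = l s r *: 1.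
Proof.
rewrite -tens1 -tensZr tcoef_tens //; congr (lcoef (lcoef _ s) r *: 1).
exact: mulr1.
Qed.
End TensorCoefficients.

Lemma residue_anticommuting (F : fieldType) (D : falgType F) (x : D)
    (y : tensor D (laurent2C F) (quat (t1 F) (t2 F))) (m : laurent (laurent F)) :
    (forall d : D, d != 0 -> d \is a GRing.unit) -> m != 0 -> y * y = m%:A ->
    tens (laurent2C F) x 1 * y = - (y * tens (laurent2C F) x 1) ->
  exists (d : D) (c : F), [/\ c != 0, d * d = c%:A & x * d = - (d * x)].
Proof.
move=> Ddiv m0 yy xy.
pose P (d : D) := x * d = - (d * x).
pose par (i j m p : int) := ((m %% 2)%Z == i) && ((p %% 2)%Z == j).
pose G (i j : int) (q : quat (t1 F) (t2 F) -> laurent (laurent F)) (s r : int) : D :=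
  famprod (fun k => q (y k)) (fun k => q (y k)) (s - i) (r - j).
have lead (i j : int) q : {morph q : u v / u + v} ->
    (forall l u, q (l *: u) = l * q u) -> (0 <= i < 2) -> (0 <= j < 2) ->
    lead_square P (par i j) (G i j q).
  move=> qD qZ i2 j2; apply: lead_square_famprod => [s r|k l].
    exact: tcoef_anticomm xy.
  by rewrite /par; lia.
have yyE s r : G 0 0 (@q0 _ _ _) s r + G 0 1 (@q1 _ _ _) s r
    + G 1 0 (@q2 _ _ _) s r - G 1 1 (@q3 _ _ _) s r = m s r *: 1.
  by rewrite -tcoef_scalar -yy tcoef_q0_sqr.
have : lead_square P
    (fun m p => par 0 0 m p || par 0 1 m p || par 1 0 m p || par 1 1 m p)
    (fun s r => m s r *: 1).
  have -> : (fun s r => m s r *: 1) = fun s r => G 0 0 (@q0 _ _ _) s r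
      + G 0 1 (@q1 _ _ _) s r + G 1 0 (@q2 _ _ _) s r - G 1 1 (@q3 _ _ _) s r :> D.
    by apply/funext => s; apply/funext => r; rewrite yyE.
  apply: lead_squareD; first by rewrite /par; lia.
    apply: lead_squareD; first by rewrite /par; lia.
      by apply: lead_squareD; [rewrite /par; lia|exact: lead|exact: lead].
    exact: lead.
  exact/lead_squareN/lead.
case=> [m00|[s [r [d [_ _ d0 xd md]]]]].
  case/eqP: m0; apply: laurentP => s; apply: laurentP => r; rewrite !lcoef0.
  by apply/eqP; have /eqP := m00 s r; rewrite scaler_eq0 oner_eq0 orbF.
have [c dd] : exists c : F, d * d = c%:A.
  case: md => [<-|/(congr1 -%R)]; first by exists (m s r).
  by rewrite opprK => <-; exists (- m s r); rewrite scaleNr.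
exists d, c; split=> //; apply: contra_neq d0 => c0.
apply/eqP/negPn/negP => d0; have /mulrI := Ddiv _ d0.
by move=> /(_ d 0); rewrite dd c0 scale0r mulr0 => /(_ erefl)/eqP; apply/negP.
Qed.

Section AnticommutingPairs.
Variables (K : fieldType) (a b : K).
Hypothesis K2 : 2%:R != 0 :> K.

Lemma quat_anticommuting (z : quat a b) (c : K) : a != 0 -> b != 0 -> c != 0 ->
    z * z = c%:A -> (forall l : K, z != l%:A) ->
  exists (w : quat a b) (m : K), [/\ m != 0, w * w = m%:A & z * w = - (w * z)].
Proof.
case: z => x0 x1 x2 x3 a0 b0 c0 zz zK.
have [e0 e1 e2 e3] : [/\
    x0 * x0 + a * x1 * x1 + b * x2 * x2 - a * b * x3 * x3 = c * 1,
    x0 * x1 + x1 * x0 - b * x2 * x3 + b * x3 * x2 = c * 0,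
    x0 * x2 + x2 * x0 + a * x1 * x3 - a * x3 * x1 = c * 0 &
    x0 * x3 + x3 * x0 + x1 * x2 - x2 * x1 = c * 0] by case: zz.
have x00 : x0 = 0.
  apply/eqP/negPn/negP => x00; case/eqP: (zK x0).
  have cancel x : 2%:R * x0 * x = 0 -> x = 0.
    by move=> /eqP; rewrite !mulf_eq0 (negPf K2) (negPf x00) => /eqP.
  have x10 : x1 = 0 by apply: cancel; rewrite -(mulr0 c) -e1; ring.
  have x20 : x2 = 0 by apply: cancel; rewrite -(mulr0 c) -e2; ring.
  have x30 : x3 = 0 by apply: cancel; rewrite -(mulr0 c) -e3; ring.
  by rewrite x10 x20 x30; congr Quat; rewrite /= ?mulr1 ?mulr0.
subst x0; have ab0 : a * b != 0 by rewrite mulf_neq0.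
(* Candidates proportional to the commutators of z with i, j and ij. *)
have [n1|n1] := eqVneq (a * x3 ^+ 2 - x2 ^+ 2) 0; last first.
  exists (Quat a b 0 0 (a * x3) x2), (a * b * (a * x3 ^+ 2 - x2 ^+ 2)).
  by split; [exact: mulf_neq0| |]; congr Quat; rewrite /=; ring.
have [n2|n2] := eqVneq (b * x3 ^+ 2 - x1 ^+ 2) 0; last first.
  exists (Quat a b 0 (b * x3) 0 x1), (a * b * (b * x3 ^+ 2 - x1 ^+ 2)).
  by split; [exact: mulf_neq0| |]; congr Quat; rewrite /=; ring.
exists (Quat a b 0 (- (b * x2)) (a * x1) 0), (a * b * (2%:R * c)).
have E : 2%:R * c = a * x1 ^+ 2 + b * x2 ^+ 2.
  rewrite -[c]mulr1 -e0.
  transitivity (a * x1 ^+ 2 + b * x2 ^+ 2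
      - a * (b * x3 ^+ 2 - x1 ^+ 2) - b * (a * x3 ^+ 2 - x2 ^+ 2)); first by ring.
  by rewrite n1 n2; ring.
by split; [by rewrite !mulf_neq0|rewrite E|]; congr Quat; rewrite /=; ring.
Qed.

Lemma quaternion_subalgebra_anticommuting (D : falgType K) (x d : D) :
    (forall y : D, y != 0 -> y \is a GRing.unit) -> a != 0 -> b != 0 ->
    x \notin 1%VS -> x * x = a%:A -> d * d = b%:A -> x * d = - (d * x) ->
  exists Q : set D, quaternion_subalgebra Q /\ Q x.
Proof.
move=> Ddiv a0 b0 xK xx dd xd.
have mulD0 (u v : D) : u * v = 0 -> u != 0 -> v = 0.
  by move=> uv0 /Ddiv/mulrI; apply; rewrite uv0 mulr0.
have [f [fi fj _]] := @quat_presentation K a b D x d xx dd xd.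
have x0 : x != 0 by apply: contraNneq xK => ->; rewrite mem0v.
have d0 : d != 0.
  by apply: contraTneq b0 => E; move: dd; rewrite E mulr0 => /esym/eqP;
     rewrite scaler_eq0 oner_eq0 orbF => ->.
have free1x (s t : K) : s%:A + t *: x = 0 -> s = 0 /\ t = 0.
  have [->|t0] := eqVneq t 0.
    by rewrite scale0r addr0 => /eqP; rewrite scaler_eq0 oner_eq0 orbF => /eqP ->.
  move=> /(congr1 ( *:%R t^-1)) /eqP; rewrite scalerDr scaler0 !scalerA mulVf //.
  rewrite scale1r addrC addr_eq0 => /eqP xE; case/negP: xK.
  by rewrite xE rpredN memvZ // memv_line.
exists (range f); split; last by exists (quat_i a b).
exists a, b; split=> //; exists f => //; apply: raddf_inj => z fz.
(* Subtracting from u + v d = 0 its conjugate by x isolates v d. *)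
have comm0 (u v : D) : x * u = u * x -> x * v = v * x -> u + v * d = 0 -> v = 0.
  move=> xu xv uvd; have : 2%:R *: (x * (v * d)) = 0.
    transitivity (x * (u + v * d) - (u + v * d) * x).
      rewrite mulrDr mulrDl xu opprD addrACA subrr add0r -[v * d * x]mulrA.
      have -> : d * x = - (x * d) by rewrite xd opprK.
      by rewrite !mulrN opprK !mulrA xv scaler_nat mulr2n.
    by rewrite uvd mulr0 mul0r subrr.
  move/eqP; rewrite scaler_eq0 (negPf K2) /= => /eqP/mulD0/(_ x0) vd.
  by apply/eqP/negPn/negP => /(mulD0 _ _ vd)/eqP; rewrite (negPf d0).
have xcomm (s t : K) : x * (s%:A + t *: x) = (s%:A + t *: x) * x.
  by rewrite mulrDr mulrDl -!scalerAr -!scalerAl mulr1 mul1r.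
pose u := (q0 z)%:A + q1 z *: x; pose v := (q2 z)%:A + q3 z *: x.
have uvd : u + v * d = 0.
  rewrite -fz [z in RHS]quatE /= !linearD !linearZ /= rmorph1 rmorphM /= fi fj.
  by rewrite /v mulrDl -!scalerAl mul1r !addrA.
have v0 : v = 0 := comm0 _ _ (xcomm _ _) (xcomm _ _) uvd.
have u0 : u = 0 by move: uvd; rewrite v0 mul0r addr0.
have [z0 z1] := free1x _ _ u0; have [z2 z3] := free1x _ _ v0.
by rewrite [z]quatE z0 z1 z2 z3 !scale0r !addr0.
Qed.
End AnticommutingPairs.

Theorem proposition4p7 (F : fieldType) (D : falgType F) (x : D)
    (hchar : (2 \notin [pchar F])%N)
    (hcentral : 'Z({:D})%VS = 1%VS)
    (hdivision : forall y : D, y != 0 -> y \is a GRing.unit)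
    (hxunit : x \is a GRing.unit)
    (hxF : x \notin 1%VS)
    (hxsq : exists2 c : F, c != 0 & x ^+ 2 = c%:A)
    (hxquat : ~ exists Q : set D, quaternion_subalgebra Q /\ Q x) :
  ~ exists Q : set (tensor D (laurent2C F) (quat (t1 F) (t2 F))),
      quaternion_subalgebra Q /\ Q (tens (laurent2C F) x 1).
Proof.
have F2 : 2%:R != 0 :> F by move: hchar; rewrite inE.
have L2 : 2%:R != 0 :> laurent (laurent F).
  by rewrite -(rmorph_nat (laurent2C F)) fmorph_eq0.
case: hxsq => c c0 xx [_ [[a [b [a0 b0 [f f_inj ->]]]] [z _ fz]]].
have xx1 : tens (laurent2C F) x 1 * tens (laurent2C F) x 1 = (laurent2C F c)%:A
    :> tensor D (laurent2C F) (quat (t1 F) (t2 F)).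
  by rewrite tensM mul1r -expr2 xx tensZl tens1.
have falg l : f l%:A = l%:A by exact: rmorph_alg.
have fM u v : f (u * v) = f u * f v by exact: rmorphM.
have zz : z * z = (laurent2C F c)%:A by apply: f_inj; rewrite fM fz falg.
have zL l : z != l%:A.
  apply: contraNneq hxF => zl; move: fz; rewrite zl falg.
  move=> /(congr1 (fun u => tcoef (@q0 _ _ _) u 0 0)).
  rewrite tcoef_scalar tcoef_tens // => E.
  have -> : x = l 0 0 *: 1 by rewrite E scale1r.
  by rewrite memvZ // memv_line.
have [w [m [m0 ww zw]]] : exists (w : quat a b) m,
    [/\ m != 0, w * w = m%:A & z * w = - (w * z)].
  by apply: quat_anticommuting zz zL => //; rewrite fmorph_eq0.
have yy : f w * f w = m%:A by rewrite -(fM w w) ww falg.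
have xy : tens (laurent2C F) x 1 * f w = - (f w * tens (laurent2C F) x 1).
  by rewrite -fz -!fM zw; exact: rmorphN.
have [d [k [k0 dd xd]]] := residue_anticommuting hdivision m0 yy xy.
by case: hxquat; apply: quaternion_subalgebra_anticommuting hdivision c0 k0 hxF _ dd xd.
Qed.
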